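(* Let $(M,d)$ be a metric space and let $Y$ be a bounded subset of $M$. Let $\mathcal{N}$ be a $\sigma$-algebra of subsets of $Y$ containing all Borel subsets of $Y$, and let $\nu$ be a measure on $\mathcal{N}$ such that $\nu(B(x,r)\cap Y)<+\infty$ for all $x\in Y$, $r>0$. Let $\upsilon_Y\in]0,+\infty[$, $s\in[0,\upsilon_Y[$, and assume that $Y$ is upper $\upsilon_Y$-Ahlfors regular with respect to $Y$. Let $K\in\mathcal{K}_{s,Y\times Y}$ and let $A[K,\cdot]$ be the integral operator $A[K,\mu](x)\equiv\int_Y K(x,y)\mu(y)\,d\nu(y)$, $x\in Y$, acting on $L^2_\nu(Y)$. If $g\in C^0_b(Y)$ and $\mu\in L^2_\nu(Y)$ satisfies $\mu-A[K,\mu]=g$ $\nu$-a.e. in $Y$, then $\mu\in C^0_b(Y)$ (i.e., $\mu$ has a bounded continuous representative).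
   Context: For $\xi\in M$, $r>0$, $B(\xi,r)=\{\eta\in M: d(\xi,\eta)<r\}$. $Y$ is upper $\upsilon$-Ahlfors regular with respect to $Y$ if there exist $r_0\in]0,+\infty]$, $c_0\in]0,+\infty[$ with $\nu(B(x,r)\cap Y)\leq c_0r^{\upsilon}$ for all $x\in Y$, $r\in]0,r_0[$. For $s\in\mathbb{R}$, $\mathcal{K}_{s,Y\times Y}$ is the set of continuous $K:\{(x,y)\in Y^2: x\neq y\}\to\mathbb{C}$ with $\sup_{x\neq y}|K(x,y)|d(x,y)^s<+\infty$. $C^0_b(Y)$ is the space of bounded continuous complex-valued functions on $Y$. *)

(* Defs.v *)
From HB Require Import structures.
From mathcomp Require Import all_boot all_order all_algebra.
From mathcomp Require Import all_classical all_reals all_analysis.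
From mathcomp Require Import complex.
Set Implicit Arguments. Unset Strict Implicit. Unset Printing Implicit Defensive.
Import Order.TTheory GRing.Theory Num.Theory.
Import numFieldNormedType.Exports.
Local Open Scope classical_set_scope.
Local Open Scope ring_scope.

Definition cabs (R : rcfType) (z : R[i]) : R :=
  Num.sqrt (complex.Re z ^+ 2 + complex.Im z ^+ 2).

Definition is_metric (R : realType) (M : Type) (dist : M -> M -> R) : Prop :=
  [/\ (forall x y, 0 <= dist x y),
      (forall x y, dist x y = 0 <-> x = y),
      (forall x y, dist x y = dist y x) &
      (forall x y z, dist x z <= dist x y + dist y z)].

Definition mball (R : realType) (M : Type) (dist : M -> M -> R) (x : M) (r : R)
  : set M := [set y | dist x y < r].

Definition mopen (R : realType) (M : Type) (dist : M -> M -> R) (U : set M) : Prop :=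
  forall x, U x -> exists2 r : R, 0 < r & mball dist x r `<=` U.

Definition Borel_sets_of (R : realType) (M : Type) (dist : M -> M -> R) (Y : set M)
  : set (set M) :=
  <<s Y, [set Y `&` U | U in mopen dist] >>.

Definition mbounded (R : realType) (M : Type) (dist : M -> M -> R) (Y : set M) : Prop :=
  exists c : R, forall x y, Y x -> Y y -> dist x y <= c.

Definition cont_on (R : realType) (M : Type) (dist : M -> M -> R) (Y : set M)
  (f : M -> R[i]) : Prop :=
  forall x, Y x -> forall e : R, 0 < e -> exists2 delta : R, 0 < delta &
    forall y, Y y -> dist x y < delta -> cabs (f y - f x) < e.

Definition C0b (R : realType) (M : Type) (dist : M -> M -> R) (Y : set M)
  (f : M -> R[i]) : Prop :=
  cont_on dist Y f /\ exists c : R, forall x, Y x -> cabs (f x) <= c.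

Definition Kclass (R : realType) (M : Type) (dist : M -> M -> R) (Y : set M)
  (s : R) (K : M -> M -> R[i]) : Prop :=
  (forall x y, Y x -> Y y -> x <> y -> forall e : R, 0 < e ->
     exists2 delta : R, 0 < delta &
     forall x' y', Y x' -> Y y' -> x' <> y' -> dist x x' < delta -> dist y y' < delta ->
       cabs (K x' y' - K x y) < e) /\
  exists c : R, forall x y, Y x -> Y y -> x <> y -> cabs (K x y) * powR (dist x y) s <= c.

Definition cintegral d (T : measurableType d) (R : realType)
  (mu : {measure set T -> \bar R}) (D : set T) (f : T -> R[i]) : R[i] :=
  Complex (\int[mu]_(x in D) complex.Re (f x)) (\int[mu]_(x in D) complex.Im (f x)).

Definition L2 d (T : measurableType d) (R : realType)
  (mu : {measure set T -> \bar R}) (Y : set T) (f : T -> R[i]) : Prop :=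
  [/\ measurable_fun Y (fun x => complex.Re (f x)),
      measurable_fun Y (fun x => complex.Im (f x)) &
      (\int[mu]_(x in Y) ((cabs (f x)) ^+ 2)%:E < +oo)%E].

Definition intop d (T : measurableType d) (R : realType)
  (nu : {measure set T -> \bar R}) (Y : set T) (K : T -> T -> R[i]) (f : T -> R[i])
  (x : T) : R[i] :=
  cintegral nu Y (fun y => K x y * f y).

(* Main.v *)
(* With F(x, r) the integral of f = |mu| over B(x, r), summing over dyadic
   shells bounds |A[K, mu](x)| by a constant plus sum_k w_k F(x, r_k), where
   r_k = delta / 2^k, w_k = c r_(k+1)^(-s); by Ahlfors regularity
   sum_k w_k nu(B(y, 5 r_k)) is uniformly small for small delta since s < upsY.
   Hence f <= G + sum_k w_k F(x, r_k) a.e., and h = (f - 2 G)^+ satisfies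
   h(x) <= sum_k w_k \int_(B(x, r_k)) h a.e.  Integrating this in x, with a
   covering argument in place of Tonelli's theorem (Y need not be separable),
   gives \int h <= 1/2 \int h, so f <= 2 G a.e.  A weakly singular operator maps
   bounded densities to bounded continuous functions, so g + A[K, mu] is the
   sought representative. *)
Require Import Defs.
From HB Require Import structures.
From mathcomp Require Import all_boot all_order all_algebra.
From mathcomp Require Import all_classical all_reals all_analysis.
From mathcomp Require Import measurable_realfun complex.
From mathcomp Require Import ring lra.
Import Order.TTheory GRing.Theory Num.Theory.
Import numFieldNormedType.Exports.
Local Open Scope classical_set_scope.
Local Open Scope ring_scope.

(** * The modulus of a complex number and its real and imaginary parts *)

Section complex_modulus.
Context (R : rcfType).
Implicit Types z w : R[i].

Lemma cabsE z : cabs z = Normc.normc z.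
Proof. by case: z. Qed.

Lemma cabs_ge0 z : 0 <= cabs z.
Proof. exact: sqrtr_ge0. Qed.

Lemma cabsM z w : cabs (z * w) = cabs z * cabs w.
Proof. by rewrite !cabsE Normc.normcM. Qed.

Lemma normr_Re_le z : `|complex.Re z| <= cabs z.
Proof. by rewrite /cabs -sqrtr_sqr; apply: ler_wsqrtr; rewrite lerDl sqr_ge0. Qed.

Lemma normr_Im_le z : `|complex.Im z| <= cabs z.
Proof. by rewrite /cabs -sqrtr_sqr; apply: ler_wsqrtr; rewrite lerDr sqr_ge0. Qed.

Lemma cabs_le z : cabs z <= `|complex.Re z| + `|complex.Im z|.
Proof.
rewrite /cabs -[leRHS]ger0_norm ?addr_ge0// -[leRHS]sqrtr_sqr; apply: ler_wsqrtr.
by rewrite sqrrD !real_normK ?num_real// addrAC lerDl mulrn_wge0// mulr_ge0.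
Qed.

Lemma ReB z w : complex.Re (z - w) = complex.Re z - complex.Re w.
Proof. by case: z w => ? ? []. Qed.

Lemma ImB z w : complex.Im (z - w) = complex.Im z - complex.Im w.
Proof. by case: z w => ? ? []. Qed.

Lemma ReD z w : complex.Re (z + w) = complex.Re z + complex.Re w.
Proof. by case: z w => ? ? []. Qed.

Lemma ImD z w : complex.Im (z + w) = complex.Im z + complex.Im w.
Proof. by case: z w => ? ? []. Qed.

Lemma ReM z w : complex.Re (z * w) =
  complex.Re z * complex.Re w - complex.Im z * complex.Im w.
Proof. by case: z w => ? ? []. Qed.

Lemma ImM z w : complex.Im (z * w) =
  complex.Re z * complex.Im w + complex.Im z * complex.Re w.
Proof. by case: z w => ? ? []. Qed.

End complex_modulus.

(** * Bounded continuous functions, reduced to real-valued components *)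

Section bounded_continuous_real.
Context (R : realType) (M : Type) (dist : M -> M -> R) (Y : set M).

Definition C0b_real (f : M -> R) : Prop :=
  (forall x (e : R), Y x -> 0 < e -> exists2 delta : R, 0 < delta &
     forall y, Y y -> dist x y < delta -> `|f y - f x| < e) /\
  exists C : R, forall x, Y x -> `|f x| <= C.

Lemma C0b_realD (f h : M -> R) :
  C0b_real f -> C0b_real h -> C0b_real (fun x => f x + h x).
Proof.
move=> [fc [Cf fb]] [hc [Ch hb]]; split.
  move=> x e Yx e0; have e2 : 0 < e / 2 by rewrite divr_gt0.
  have [d1 d10 d1P] := fc x _ Yx e2; have [d2 d20 d2P] := hc x _ Yx e2.
  exists (Num.min d1 d2); first by rewrite lt_min d10.
  move=> y Yy; rewrite lt_min => /andP[/(d1P _ Yy) + /(d2P _ Yy)].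
  by rewrite !ltr_norml; lra.
exists (Cf + Ch) => x Yx; apply: le_trans (ler_normD _ _) _.
by apply: lerD; [exact: fb|exact: hb].
Qed.

Lemma C0b_realN (f : M -> R) : C0b_real f -> C0b_real (fun x => - f x).
Proof.
move=> [fc [C fb]]; split; last by exists C => x Yx; rewrite normrN; exact: fb.
move=> x e Yx e0; have [delta d0 dP] := fc x e Yx e0.
exists delta => // y Yy /(dP _ Yy); by rewrite -opprD normrN.
Qed.

Lemma C0bP (f : M -> R[i]) : C0b dist Y f <->
  C0b_real (fun x => complex.Re (f x)) /\ C0b_real (fun x => complex.Im (f x)).
Proof.
split=> [[fc [C fb]]|[[rc [Cr rb]] [ic [Ci ib]]]].
  split; split.
  - move=> x e Yx e0; have [delta d0 dP] := fc x Yx e e0.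
    exists delta => // y Yy /(dP _ Yy); rewrite -ReB; apply: le_lt_trans.
    exact: normr_Re_le.
  - by exists C => x Yx; apply: le_trans (fb x Yx); exact: normr_Re_le.
  - move=> x e Yx e0; have [delta d0 dP] := fc x Yx e e0.
    exists delta => // y Yy /(dP _ Yy); rewrite -ImB; apply: le_lt_trans.
    exact: normr_Im_le.
  - by exists C => x Yx; apply: le_trans (fb x Yx); exact: normr_Im_le.
split.
  move=> x Yx e e0; have e2 : 0 < e / 2 by rewrite divr_gt0.
  have [d1 d10 d1P] := rc x _ Yx e2; have [d2 d20 d2P] := ic x _ Yx e2.
  exists (Num.min d1 d2); first by rewrite lt_min d10.
  move=> y Yy; rewrite lt_min => /andP[/(d1P _ Yy) + /(d2P _ Yy)].
  move=> lr li; apply: le_lt_trans (cabs_le _ _) _.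
  by rewrite ReB ImB; lra.
exists (Cr + Ci) => x Yx; apply: le_trans (cabs_le _ _) _.
by apply: lerD; [exact: rb|exact: ib].
Qed.

End bounded_continuous_real.

Arguments C0b_real {R M}.
Arguments C0b_realD {R M dist Y f h}.
Arguments C0b_realN {R M dist Y f}.
Arguments C0bP {R M dist Y f}.

(** * Metric balls and Borel measurability relative to [Y] *)

Section metric_measure.
Context (R : realType) (disp : measure_display) (M : measurableType disp)
  (dist : M -> M -> R) (Y : set M) (nu : {measure set M -> \bar R}).
Hypotheses (dist_metric : is_metric dist) (mY : measurable Y)
  (borelY : Borel_sets_of dist Y `<=` measurable).

Let Bl x r := mball dist x r `&` Y.

Lemma mopen_measurable (U : set M) : mopen dist U -> measurable (U `&` Y).
Proof.
move=> oU; apply: borelY; apply: sub_gen_smallest; exists U => //; exact: setIC.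
Qed.

Lemma mopen_mball (x : M) (r : R) : mopen dist (mball dist x r).
Proof.
have [_ _ _ tri] := dist_metric.
move=> y /= xy; exists (r - dist x y); first by rewrite subr_gt0.
by move=> z /=; rewrite /mball/= => yz; have := tri x y z; lra.
Qed.

Lemma measurable_mball (x : M) (r : R) : measurable (Bl x r).
Proof. exact/mopen_measurable/mopen_mball. Qed.

(** * Integrals over balls, iterated without separability *)

Section countable_family.
Local Open Scope ereal_scope.
Context (h : M -> R).
Hypotheses (mh : measurable_fun Y h) (h0 : forall y, Y y -> (0 <= h y)%R)
  (hfin : \int[nu]_(y in Y) (h y)%:E < +oo).

Let mhE : measurable_fun Y (EFin \o h).
Proof. exact/measurable_EFinP. Qed.

Let h0E y : Y y -> 0 <= (h y)%:E.
Proof. by rewrite lee_fin; exact: h0. Qed.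

(** For each [n], only finitely many [z] in [E] give an integral above [n.+1%:R^-1], since
    infinitely many disjoint such sets would exceed the finite integral of [h] over [Y]. [E] is the
    union of these finite sets. *)
Lemma countable_disjoint_integral_gt0 (E : set M) (F : M -> set M) :
  (forall z, measurable (F z)) -> (forall z, F z `<=` Y) ->
  trivIset E F -> (forall z, E z -> 0 < \int[nu]_(y in F z) (h y)%:E) ->
  countable E.
Proof.
move=> mF FY tF F0.
have fn z : \int[nu]_(y in F z) (h y)%:E \is a fin_num.
  rewrite ge0_fin_numE; last by apply: integral_ge0 => y /FY; exact: h0E.
  apply: le_lt_trans hfin; apply: ge0_subset_integral => //; exact: FY.
have EU : E `<=` \bigcup_n
    [set z | E z /\ (n.+1%:R^-1)%:E < \int[nu]_(y in F z) (h y)%:E].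
  move=> z Ez; have := F0 z Ez.
  rewrite -(fineK (fn z)) lte_fin => /ltr_add_invr[k /[!add0r] kz].
  by exists k => //; split => //; rewrite -(fineK (fn z)) lte_fin.
apply: sub_countable (subset_card_le EU) _.
apply: bigcup_countable => // n _; apply: finite_set_countable.
apply: contrapT => /infiniteP/pcard_leP/injfunPex[/= q q_fun q_inj].
have [N NI] : exists N : nat, \int[nu]_(y in Y) (h y)%:E < N%:R%:E.
  have If : \int[nu]_(y in Y) (h y)%:E \is a fin_num.
    by rewrite ge0_fin_numE//; exact: integral_ge0.
  exists (Num.truncn (fine (\int[nu]_(y in Y) (h y)%:E))).+1.
  by rewrite -{1}(fineK If) lte_fin truncnS_gt.
have : \int[nu]_(y in \bigcup_k F (q k)) (h y)%:E <= \int[nu]_(y in Y) (h y)%:E.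
  apply: ge0_subset_integral => //.
    by apply: bigcup_measurable => k _.
  by apply: bigcup_sub => k _; exact: FY.
rewrite leNgt => /negP; apply; apply: (lt_le_trans NI).
rewrite ge0_integral_bigcup//; last 3 first.
- apply: measurable_funS mhE => //.
  by apply: bigcup_sub => k _; exact: FY.
- by move=> y [k _ /FY]; exact: h0E.
- apply/trivIsetP => i j _ _ ij.
  move/trivIsetP : tF; apply.
  + by have [] := q_fun i I.
  + by have [] := q_fun j I.
  + by apply: contra_neq ij => /q_inj; apply; rewrite inE.
(* The first [N * n.+1] terms, each above [n.+1%:R^-1], already sum to at least [N]. *)
apply: (le_trans _ (nneseries_lim_ge (N * n.+1)%N _)) => //.
  apply: (@le_trans _ _ (\sum_(0 <= k < (N * n.+1)%N) (n.+1%:R^-1)%:E)).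
    rewrite sumEFin lee_fin sumr_const_nat subn0 -[leRHS]mulr_natr natrM mulrC mulfK//.
  by apply: lee_sum => k _; apply: ltW; have [] := q_fun k I.
by move=> k _ _; apply: integral_ge0 => y /FY; exact: h0E.
Qed.

(* The pairs at distance [< r] need not form a measurable subset of [Y * Y]
   when [Y] is not separable, and Tonelli's theorem can then fail; it is
   replaced by a covering of [{x | 0 < \int_(B(x, r)) h}] with countably many
   balls [B(z i, 2 r)], on which [\int_(B(x, r)) h <= \int_(B(z i, 3 r)) h]. *)
Lemma schur_ball (r m : R) :
  (0 < r)%R -> (0 <= m)%R -> (forall y, Y y -> nu (Bl y (5 * r)) <= m%:E) ->
  exists Phi : M -> \bar R, [/\ measurable_fun Y Phi,
    forall x, Y x -> 0 <= Phi x,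
    forall x, Y x -> \int[nu]_(y in Bl x r) (h y)%:E <= Phi x &
    \int[nu]_(y in Y) Phi y <= m%:E * \int[nu]_(y in Y) (h y)%:E].
Proof.
move=> r0 m0 num.
have [d0 _ dC tri] := dist_metric.
have dxx x : dist x x = 0%R by have [_ H _ _] := dist_metric; exact/H.
pose H x t := \int[nu]_(y in Bl x t) (h y)%:E.
have H0 x t : 0 <= H x t by apply: integral_ge0 => y [_]; exact: h0E.
pose P := [set x | Y x /\ 0 < H x r].
(* [E] is a maximal set of centres in [P] with pairwise disjoint balls of radius [r]. It is
   countable because [h] has positive integral on each ball. By maximality, the ball about any [x]
   in [P] meets one of them, so [x] is within [2 * r] of a centre. *)
have [E [EP tE maxE]] := ex_maximal_disjoint_subcollection (Bl^~ r) P.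
have cE : countable E.
  apply: (countable_disjoint_integral_gt0 _ _ _ _ tE) => [z|z y []//|z /EP []//].
  exact: measurable_mball.
have PE x : P x -> exists2 z, E z & (dist z x < 2 * r)%R.
  move=> Px; apply: contrapT => nex.
  have nEx : ~ E x by move=> Ex; apply: nex; exists x => //; rewrite dxx; lra.
  apply: (maxE (E `|` [set x])).
  - split; first by left.
    by move=> /(_ x (or_intror erefl)).
  - by move=> z [/EP//|->].
  - have xz z : E z -> Bl x r `&` Bl z r !=set0 -> False.
      move=> Ez [y [[/= xy _] [/= zy _]]]; apply: nex; exists z => //.
      by have := tri z y x; rewrite (dC y x); move: xy zy; rewrite /mball/=; lra.
    move=> i j [Ei|->] [Ej|->]//; first exact: tE.
    + by rewrite setIC => /xz -/(_ Ei).
    + by move=> /xz -/(_ Ej).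
have [[x0 Ex0]|E0] := pselect (E !=set0); last first.
  exists (cst 0); split => //.
  - move=> x Yx; rewrite leNgt; apply/negP => Hx.
    by have [z Ez _] := PE x (conj Yx Hx); apply: E0; exists z.
  - by rewrite integral0 mule_ge0//; exact: integral_ge0.
have [z [Ez zE]] : exists z : nat -> M, (forall n, E (z n)) /\
    forall e, E e -> exists n, z n = e.
  (* [z] inverts an injection of [E] into the naturals, with [x0] at the values not attained.
     Repetitions are harmless, because [seqDU] makes the sets [A n] disjoint. *)
  have [f f_inj] := countable_injP _ cE.
  pose P' n e := E e /\ f e = n.
  exists (fun n => if pselect (exists e, P' n e) is left ex
                   then projT1 (cid ex) else x0); split=> [n|e Ee].
    by case: pselect => // ex; case: (projT2 (cid ex)).
  exists (f e); case: pselect => [ex|[]]; last by exists e.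
  by have [Ee' /f_inj] := projT2 (cid ex); rewrite !inE; apply.
have Yz n : Y (z n) by have [] := EP _ (Ez n).
pose A := seqDU (fun n => Bl (z n) (2 * r)).
have mA n : measurable (A n).
  by apply: seqDU_measurable => k; exact: measurable_mball.
have tA : trivIset setT A by exact: trivIset_seqDU.
have AB n : A n `<=` Bl (z n) (2 * r) by exact: subset_seqDU.
have AY n : A n `<=` Y by move=> x /AB[].
have nuA n : nu (A n) = (fine (nu (A n)))%:E.
  rewrite fineK// ge0_fin_numE//.
  apply: (@le_lt_trans _ _ m%:E); last exact: ltry.
  apply: le_trans (num (z n) (Yz n)); apply: le_measure; rewrite ?inE//.
    exact: measurable_mball.
  by move=> x /AB[/= zx Yx]; split => //; move: zx; rewrite /mball/=; lra.
have H3fin n : H (z n) (3 * r)%R = (fine (H (z n) (3 * r)%R))%:E.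
  rewrite fineK// ge0_fin_numE//; apply: le_lt_trans hfin.
  apply: ge0_subset_integral => //; first exact: measurable_mball.
  by move=> x [].
(* [Phi] is constant on each [A n]. For [x] in [A n], the ball of radius [r] about [x] lies in the
   ball of radius [3 * r] about [z n], as [2 + 1 = 3]. *)
pose Phi x := \sum_(0 <= n <oo) (H (z n) (3 * r)%R * (\1_(A n) x)%:E).
have Phi0 n x : 0 <= H (z n) (3 * r)%R * (\1_(A n) x)%:E by rewrite mule_ge0.
have mPhi n : measurable_fun Y (fun x => H (z n) (3 * r)%R * (\1_(A n) x)%:E).
  apply: emeasurable_funM => //.
  by apply/measurable_EFinP; exact: measurable_indic.
exists Phi; split.
- exact: ge0_emeasurable_sum.
- by move=> x Yx; exact: nneseries_ge0.
- move=> x Yx; rewrite -/(H x r).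
  have [Hx|] := ltP 0 (H x r); last by move/le_trans; apply; exact: nneseries_ge0.
  have [n _ Anx] : (\bigcup_n A n) x.
    rewrite -seqDU_bigcup_eq.
    have [e /zE[n <-] ex] := PE x (conj Yx Hx); by exists n.
  rewrite /Phi (nneseriesD1 (n := n))//.
  have -> : \1_(A n) x = 1%R :> R by rewrite indicE (mem_set Anx).
  rewrite mule1.
  apply: le_trans (leeDl _ (nneseries_ge0 _)); last by [].
  apply: ge0_subset_integral => //; try exact: measurable_mball.
  + by apply: measurable_funS mhE => // ? [].
  + by move=> ? [_]; exact: h0E.
  + move=> y [/= xy Yy]; split => //; have [/= zx _] := AB _ _ Anx.
    by have := tri (z n) x y; move: zx xy; rewrite /mball/=; lra.
rewrite integral_nneseries//.
(* Integrating the constant [H (z n) (3 * r)] over [A n] gives a product, which is read back as an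
   integral in [y]. The variables are thus exchanged term by term. *)
have -> : \sum_(0 <= n <oo) \int[nu]_(x in Y) (H (z n) (3 * r)%R * (\1_(A n) x)%:E)
    = \sum_(0 <= n <oo) \int[nu]_(y in Y)
        (nu (A n) * ((h y)%:E * (\1_(Bl (z n) (3 * r)) y)%:E)).
  apply: eq_eseriesr => n _.
  rewrite H3fin ge0_integralZl_EFin//; last 2 first.
  - by apply/measurable_EFinP; exact: measurable_indic.
  - by rewrite fine_ge0//; exact: H0.
  rewrite integral_indic// -H3fin (setIidl (AY n)) muleC.
  rewrite [in RHS]nuA ge0_integralZl_EFin//; last 2 first.
  - by move=> y Yy; rewrite mule_ge0//; exact: h0E.
  - apply: emeasurable_funM => //; apply/measurable_EFinP.
    exact/measurable_indic/measurable_mball.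
  rewrite -[in RHS](nuA n); congr (_ * _); rewrite /H.
  transitivity (\int[nu]_(y in Y `&` Bl (z n) (3 * r)) (h y)%:E).
    by rewrite /Bl setICA setIid.
  by rewrite integral_mkcondr epatch_indic.
rewrite -integral_nneseries//; last 2 first.
- move=> n; apply: emeasurable_funM => //; apply: emeasurable_funM => //.
  by apply/measurable_EFinP/measurable_indic/measurable_mball.
- by move=> n y Yy; rewrite !mule_ge0//; exact: h0E.
rewrite -ge0_integralZl_EFin//.
apply: ge0_le_integral => //.
- by move=> y Yy; apply: nneseries_ge0 => n _ _; rewrite !mule_ge0//; exact: h0E.
- apply: ge0_emeasurable_sum => [n y Yy _|n _].
    by rewrite !mule_ge0//; exact: h0E.
  apply: emeasurable_funM => //; apply: emeasurable_funM => //.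
  by apply/measurable_EFinP/measurable_indic/measurable_mball.
- by apply: emeasurable_funM => //; exact: mhE.
move=> y Yy.
under eq_eseriesr do rewrite muleCA.
rewrite nneseriesZl; last by move=> n _; exact: mule_ge0.
rewrite muleC lee_wpmul2r//; first exact: h0E.
apply: le_trans (num y Yy).
(* The sets [A n] with [n] in [D] are disjoint and lie in the ball of radius [5 * r] about [y], as
   [3 + 2 = 5]. *)
pose D := [set n | Bl (z n) (3 * r) y].
have -> : \sum_(0 <= n <oo) nu (A n) * (\1_(Bl (z n) (3 * r)) y)%:E =
    nu (\bigcup_(n in D) A n).
  rewrite measure_bigcup//; last exact: sub_trivIset tA.
  rewrite [RHS]eseries_mkcond; apply: eq_eseriesr => n _.
  rewrite indicE /D; case: ifPn => [|]; rewrite ?inE => nD.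
    by rewrite (mem_set (nD : Bl _ _ y)) mule1.
  by rewrite memNset ?mule0// => yD; move/negP: nD; apply; rewrite inE.
apply: le_measure; rewrite ?inE.
- by apply: bigcup_measurable => n _.
- exact: measurable_mball.
move=> x [n [/= zy _]] /AB[/= zx Yx]; split => //.
have := tri y (z n) x; rewrite (dC y (z n)).
by move: zx zy; rewrite /mball/=; lra.
Qed.
End countable_family.

(** * Absorption of a small potential *)

Section absorption.
Local Open Scope ereal_scope.
Context (rho w m : nat -> R) (f : M -> R) (G : R).
Hypotheses (rho0 : forall k, (0 < rho k)%R) (w0 : forall k, (0 <= w k)%R)
  (m0 : forall k, (0 <= m k)%R)
  (num : forall k y, Y y -> nu (Bl y (5 * rho k)) <= (m k)%:E)
  (wm : \sum_(0 <= k <oo) (w k * m k)%:E <= 2^-1%:E)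
  (mf : measurable_fun Y f) (f0 : forall y, Y y -> (0 <= f y)%R)
  (ffin : \int[nu]_(y in Y) (f y)%:E < +oo) (G0 : (0 <= G)%R).

(** Inserting [f <= 2 * G + h] into the potential, the constant contributes at most
    [2 * G * 2^-1 = G]. Added to the given [G] this is [2 * G] again, so the excess [h] is bounded
    by its own potential alone. *)
Lemma ae_bounded_of_potential_le :
  {ae nu, forall x, Y x -> (f x)%:E <=
    G%:E + \sum_(0 <= k <oo) ((w k)%:E * \int[nu]_(y in Bl x (rho k)) (f y)%:E)} ->
  {ae nu, forall x, Y x -> (f x <= 2 * G)%R}.
Proof.
move=> fle.
pose h x := Num.max (f x - 2 * G)%R 0%R.
have mh : measurable_fun Y h.
  by apply: measurable_maxr => //; exact: measurable_funB.
have h0 y : Y y -> (0 <= h y)%R by move=> _; rewrite le_max lexx orbT.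
have h0E y : Y y -> 0 <= (h y)%:E by rewrite lee_fin; exact: h0.
have f0E y : Y y -> 0 <= (f y)%:E by rewrite lee_fin; exact: f0.
have mhE : measurable_fun Y (EFin \o h) by exact/measurable_EFinP.
have mfE : measurable_fun Y (EFin \o f) by exact/measurable_EFinP.
have hf y : Y y -> (h y <= f y)%R.
  by move=> Yy; have := G0; rewrite /h ge_max f0// andbT; lra.
have fh y : (f y <= 2 * G + h y)%R.
  by have : (f y - 2 * G <= h y)%R by [rewrite le_max lexx]; lra.
have hfin : \int[nu]_(y in Y) (h y)%:E < +oo.
  by apply: le_lt_trans ffin; apply: ge0_le_integral.
have /choice[Phi PhiP] k := schur_ball h mh h0 hfin _ _ (rho0 k) (m0 k) (num k).
have mPhi k := let: And4 H _ _ _ := PhiP k in H.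
have Phi0 k := let: And4 _ H _ _ := PhiP k in H.
have HPhi k := let: And4 _ _ H _ := PhiP k in H.
have IPhi k := let: And4 _ _ _ H := PhiP k in H.
pose Psi x := \sum_(0 <= k <oo) ((w k)%:E * Phi k x).
have wPhi0 k x : Y x -> 0 <= (w k)%:E * Phi k x.
  by move=> Yx; rewrite mule_ge0 ?lee_fin//; exact: Phi0.
have mwPhi k : measurable_fun Y (fun x => (w k)%:E * Phi k x).
  by apply: emeasurable_funM.
have mPsi : measurable_fun Y Psi.
  by apply: ge0_emeasurable_sum => // k x Yx _; exact: wPhi0.
have Psi0 x : Y x -> 0 <= Psi x.
  by move=> Yx; apply: nneseries_ge0 => k _ _; exact: wPhi0.
have hPsi : {ae nu, forall x, Y x -> (h x)%:E <= Psi x}.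
  apply: filterS fle => x fx Yx.
  suff : (f x)%:E <= (2 * G)%:E + Psi x.
    rewrite /h; case: (Psi x) (Psi0 x Yx) => [p| |]//=.
      by rewrite !lee_fin ge_max => -> ; rewrite andbT; lra.
    by move=> _ _; rewrite leey.
  apply: le_trans (fx Yx) _.
  apply: (@le_trans _ _ (G%:E + \sum_(0 <= k <oo)
      ((2 * G)%:E * (w k * m k)%:E + (w k)%:E * Phi k x))).
    apply: leeD => //; apply: lee_nneseries => [k _ _|k _].
      by rewrite mule_ge0 ?lee_fin//; apply: integral_ge0 => y [_]; exact: f0E.
    rewrite -EFinM mulrCA EFinM -ge0_muleDr; last 2 first.
    - by rewrite lee_fin !mulr_ge0.
    - exact: Phi0.
    apply: lee_wpmul2l; first by rewrite lee_fin.
    have BY : Bl x (rho k) `<=` Y by move=> ? [].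
    have mB := measurable_mball x (rho k).
    apply: (@le_trans _ _ (\int[nu]_(y in Bl x (rho k)) ((2 * G)%:E + (h y)%:E))).
      apply: ge0_le_integral => //.
      - by move=> y /BY; exact: f0E.
      - exact: measurable_funS mfE.
      - by apply: emeasurable_funD => //; exact: measurable_funS mhE.
      - by move=> y _; rewrite -EFinD lee_fin.
    rewrite ge0_integralD//; last 3 first.
    - by move=> y _; rewrite lee_fin mulr_ge0.
    - by move=> y /BY; exact: h0E.
    - exact: measurable_funS mhE.
    apply: leeD; last exact: HPhi.
    rewrite [leRHS]EFinM [leLHS](integral_cst nu mB (2 * G)%:E).
    rewrite lee_wpmul2l ?lee_fin ?mulr_ge0//.
    apply: le_trans (num k x Yx); apply: le_measure; rewrite ?inE//.
      exact: measurable_mball.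
    by move=> y [/= xy Yy]; split => //; move: xy (rho0 k); rewrite /mball/=; lra.
  rewrite nneseriesD; last 2 first.
  - by move=> k _ _; rewrite -EFinM lee_fin !mulr_ge0.
  - by move=> k _ _; exact: wPhi0.
  rewrite addeA leeD2r// nneseriesZl; last by move=> k _; rewrite lee_fin mulr_ge0.
  apply: (@le_trans _ _ (G%:E + (2 * G)%:E * 2^-1%:E)).
    by rewrite leeD2l// lee_wpmul2l ?lee_fin ?mulr_ge0.
  by rewrite -EFinM -EFinD lee_fin; lra.
(* By [IPhi], the integral of [Psi] is at most the sum of the [w k * m k], hence [2^-1], times the
   integral of [h]. *)
have Ih : \int[nu]_(x in Y) (h x)%:E <= 2^-1%:E * \int[nu]_(x in Y) (h x)%:E.
  apply: (@le_trans _ _ (\int[nu]_(x in Y) Psi x)).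
    exact: ae_ge0_le_integral.
  rewrite /Psi integral_nneseries//.
  apply: (@le_trans _ _ (\sum_(0 <= k <oo)
      (\int[nu]_(x in Y) (h x)%:E * (w k * m k)%:E))).
    apply: lee_nneseries => k.
      by move=> _ _; apply: integral_ge0 => x; exact: wPhi0.
    move=> _; rewrite ge0_integralZl_EFin//; last exact: Phi0.
    by rewrite [leRHS]muleC EFinM -muleA lee_wpmul2l ?lee_fin//; exact: IPhi.
  have -> : \int[nu]_(x in Y) (h x)%:E = (fine (\int[nu]_(x in Y) (h x)%:E))%:E.
    by rewrite fineK// ge0_fin_numE//; exact: integral_ge0.
  rewrite nneseriesZl; last by move=> k _; rewrite lee_fin mulr_ge0.
  by rewrite muleC lee_wpmul2r// lee_fin fine_ge0//; exact: integral_ge0.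
(* An integral bounded by half of itself vanishes, because [hfin] makes it finite. *)
have {}Ih : \int[nu]_(x in Y) `|(h x)%:E| = 0.
  rewrite (eq_integral (EFin \o h)); last first.
    by move=> x; rewrite inE => Yx; rewrite gee0_abs//; exact: h0E.
  have := @integral_ge0 _ _ _ nu Y _ h0E; move: Ih hfin.
  by case: (integral nu Y _) => [v| |]//=; rewrite -EFinM !lee_fin => ? _ ?;
     congr EFin; lra.
have /(ae_eq_integral_abs nu mY mhE) := Ih.
apply: filterS => x hx Yx; have /= [hx0] := hx Yx.
by have := fh x; rewrite hx0 addr0.
Qed.
End absorption.

(** * Weakly singular kernels and their dyadic decomposition *)

Section singular_kernel.
Context (s ups c0 r1 : R).
Hypotheses (s0 : 0 <= s) (s_ups : s < ups) (c0_gt0 : 0 < c0) (r1_gt0 : 0 < r1)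
  (ahlfors : forall x r, Y x -> 0 < r -> r < r1 ->
    (nu (Bl x r) <= (c0 * r `^ ups)%:E)%E).

Let dyad (delta : R) (k : nat) : R := delta * 2^-1 ^+ k.

(** The index [k.+1] selects the inner radius of the shell between [dyad delta k.+1] and
    [dyad delta k]; as [0 <= s], a kernel of order [s] is bounded on the shell by this value. *)
Let weight (c delta : R) (k : nat) : R := c * dyad delta k.+1 `^ (- s).

Let dyad_gt0 delta k : 0 < delta -> 0 < dyad delta k.
Proof. by move=> d0; rewrite mulr_gt0// exprn_gt0// invr_gt0. Qed.

Let weight_ge0 c delta k : 0 <= c -> 0 <= weight c delta k.
Proof. by move=> c_ge0; rewrite mulr_ge0// powR_ge0. Qed.

Lemma powR_small (t C e r : R) : 0 < t -> 0 <= C -> 0 < e -> 0 < r ->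
  exists2 delta, 0 < delta < r & C * delta `^ t <= e.
Proof.
move=> t0 C0 e0 r0.
(* Adding 1 avoids a zero denominator when [C = 0] and still gives [C * q <= e]. *)
pose q := e / (C + 1).
have q0 : 0 < q by rewrite divr_gt0// ltr_wpDl.
exists (Num.min (r / 2) (q `^ t^-1)).
  apply/andP; split; last by rewrite gt_min; apply/orP; left; lra.
  by rewrite lt_min powR_gt0// andbT; lra.
apply: (@le_trans _ _ (C * q)).
  apply: ler_wpM2l => //.
  have qE : (q `^ t^-1) `^ t = q by rewrite -powRrM mulVf ?gt_eqF// powRr1// ltW.
  rewrite -[leRHS]qE; apply: ge0_ler_powR; rewrite ?nnegrE ?powR_ge0 ?(ltW t0)//.
    by rewrite le_min powR_ge0 andbT; lra.
  by rewrite ge_min lexx orbT.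
rewrite /q mulrCA; apply: ler_piMr; first exact: ltW.
by rewrite ler_pdivrMr ?mul1r ?lerDl// ltr_wpDl.
Qed.

(** The terms are geometric with ratio [2 ^ (s - ups)], below 1 because [s < ups]. Their leading
    factor is a multiple of [delta ^ (ups - s)], so a small [delta] suffices. The bound
    [5 * delta < r1] keeps the enlarged balls in the range of the Ahlfors estimate. *)
Lemma weight_ball_sum (c e : R) : 0 <= c -> 0 < e ->
  exists2 delta, 0 < delta /\ 5 * delta < r1 &
    (\sum_(0 <= k <oo) (weight c delta k * (c0 * (5 * dyad delta k) `^ ups))%:E
       <= e%:E)%E.
Proof.
move=> c_ge0 e0.
pose t := ups - s; have t0 : 0 < t by rewrite subr_gt0.
pose z : R := 2^-1 `^ t.
have z_ge0 : 0 <= z by exact: powR_ge0.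
have z_lt1 : z < 1.
  suff : z < 1 `^ t by rewrite powR1.
  by apply: gt0_ltr_powR; rewrite ?nnegrE//; lra.
pose C := c * 2 `^ s * c0 * 5 `^ ups.
have C_ge0 : 0 <= C by rewrite !mulr_ge0 ?powR_ge0// ltW.
have r5 : 0 < r1 / 5 by rewrite divr_gt0.
have z1 : 0 < 1 - z by rewrite subr_gt0.
have [delta /andP[d0 dr] dC] :=
  powR_small t (C / (1 - z)) e (r1 / 5) t0 (divr_ge0 C_ge0 (ltW z1)) e0 r5.
exists delta; first by split => //; move: dr; lra.
have termE k : weight c delta k * (c0 * (5 * dyad delta k) `^ ups) =
    geometric (C * delta `^ t) z k.
  have dk0 := dyad_gt0 delta k d0.
  rewrite /weight /C /geometric/=.
  have -> : dyad delta k.+1 = dyad delta k * 2^-1 by rewrite /dyad exprSr mulrA.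
  have Dt : dyad delta k `^ (- s) * dyad delta k `^ ups = delta `^ t * z ^+ k.
    rewrite -powRD; last by rewrite (gt_eqF dk0) implybT.
    rewrite [- s + ups]addrC -/t /dyad powRM ?(ltW d0) ?exprn_ge0//.
    congr (_ * _); have half_ge0 : (0 : R) <= 2^-1 by rewrite invr_ge0.
    rewrite -[RHS](powR_mulrn k z_ge0) -[X in X `^ t = _](powR_mulrn k half_ge0).
    by rewrite /z -!powRrM [t * _]mulrC.
  have H2 : (2^-1 : R) `^ (- s) = 2 `^ s by rewrite -powR_inv1// -powRrM mulN1r opprK.
  have dk_ge0 := ltW dk0.
  rewrite (@powRM R (dyad delta k) 2^-1)// (@powRM R 5 (dyad delta k))// H2.
  by rewrite -[RHS]mulrA -Dt; ring.
apply: lime_le.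
  apply: is_cvg_nneseries => k _ _.
  rewrite lee_fin termE /geometric/=; apply: mulr_ge0; last exact: exprn_ge0.
  by rewrite mulr_ge0 ?powR_ge0.
apply: nearW => n; rewrite sumEFin lee_fin.
rewrite (eq_bigr _ (fun k _ => termE k)).
rewrite -[leLHS]/(series (geometric (C * delta `^ t) z) n).
rewrite geometric_seriesE; last by rewrite lt_eqF.
have az_ge0 : 0 <= C * delta `^ t / (1 - z).
  by rewrite divr_ge0 ?mulr_ge0 ?powR_ge0// ltW.
apply: (@le_trans _ _ (C * delta `^ t / (1 - z))); last by rewrite mulrAC.
by rewrite [leLHS]mulrAC; apply: ler_piMr; rewrite ?gerBl ?exprn_ge0.
Qed.

Let dist_gt0 x y : x <> y -> 0 < dist x y.
Proof.
have [d0 deq0 _ _] := dist_metric.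
by move=> xy; rewrite lt_neqAle d0 andbT eq_sym; apply/eqP => /deq0.
Qed.

Lemma measurable_singleton (x : M) : measurable ([set x] `&` Y).
Proof.
have [_ _ dC _] := dist_metric.
have -> : [set x] `&` Y = Y `\` (~` [set x] `&` Y).
  apply/seteqP; split => z [zx Yz]; first by split => // -[].
  by split => //; apply: contrapT => zx'; exact: Yz.
apply: measurableD => //; apply: mopen_measurable => z /= zx.
exists (dist z x); first exact: dist_gt0.
by move=> y + yx; rewrite /mball/= yx ltxx.
Qed.

(** The point lies in balls of arbitrarily small radius, whose measure tends to 0 by Ahlfors
    regularity. The diagonal, where the kernel is unconstrained, can therefore be ignored under the
    integral. *)
Lemma measure_singleton (x : M) : Y x -> nu ([set x] `&` Y) = 0%E.
Proof.
move=> Yx; apply/eqP; rewrite eq_le measure_ge0 andbT.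
apply/lee_addgt0Pr => e e0; rewrite add0e.
have [r /andP[r0 rr1] re] :=
  powR_small ups c0 e r1 (le_lt_trans s0 s_ups) (ltW c0_gt0) e0 r1_gt0.
apply: (@le_trans _ _ (c0 * r `^ ups)%:E); last by rewrite lee_fin.
apply: le_trans (ahlfors x r Yx r0 rr1); apply: le_measure; rewrite ?inE.
- exact: measurable_singleton.
- exact: measurable_mball.
move=> _ [-> _]; split => //; rewrite /mball/=.
by have [_ deq0 _ _] := dist_metric; rewrite ((deq0 x x).2 erefl).
Qed.

(** If [delta <= dist x y], the constant term dominates [a]. Otherwise [dyad delta n.+1 <= dist x y
    < dyad delta n] for some [n], and the term of index [n] alone dominates [a]. *)
Lemma kernel_le_dyadic (c delta a : R) (x y : M) :
  0 <= c -> 0 < delta -> Y y -> x <> y -> a * dist x y `^ s <= c ->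
  (a%:E <= (c * delta `^ (- s))%:E +
    \sum_(0 <= k <oo) (weight c delta k)%:E * (\1_(Bl x (dyad delta k)) y)%:E)%E.
Proof.
move=> c_ge0 d0 Yy /dist_gt0; set t := dist x y => t0 atc.
have le_of u : 0 < u -> u <= t -> a <= c * u `^ (- s).
  move=> u0 ut; rewrite powRN ler_pdivlMr ?powR_gt0//.
  have [a0|/ltW a0] := leP 0 a.
    apply: le_trans atc; apply: ler_wpM2l => //.
    by apply: ge0_ler_powR => //; rewrite nnegrE ltW.
  by apply: le_trans c_ge0; rewrite mulr_le0_ge0 ?powR_ge0.
have term0 k : (0 <= (weight c delta k)%:E * (\1_(Bl x (dyad delta k)) y)%:E)%E.
  by rewrite mule_ge0 ?lee_fin ?weight_ge0.
have [dt|td] := leP delta t.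
  apply: (@le_trans _ _ (c * delta `^ (- s))%:E); first by rewrite lee_fin le_of.
  by rewrite leeDl//; apply: nneseries_ge0.
have exn : exists n, dyad delta n <= t.
  have /cvgrPdist_le/(_ _ t0)[N _ /(_ N (leqnn N))] :
      dyad delta n @[n --> \oo] --> (0 : R).
    rewrite -[X in _ --> X](mulr0 delta); apply: cvgM; first exact: cvg_cst.
    by apply: cvg_expr; rewrite ger0_norm//; lra.
  by rewrite sub0r normrN gtr0_norm ?dyad_gt0//; exists N.
(* The least index with radius at most [t] is positive, since [dyad delta 0] is [delta > t].
   Minimality places [t] below the preceding radius. *)
case: (ex_minnP exn) => -[|n] nt nmin.
  by move: nt; rewrite /dyad expr0 mulr1 leNgt td.
have tn : t < dyad delta n by rewrite ltNge; apply/negP => /nmin; rewrite ltnn.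
apply: (@le_trans _ _ (weight c delta n)%:E).
  by rewrite lee_fin; apply: le_of => //; exact: dyad_gt0.
rewrite (nneseriesD1 (n := n))//.
have -> : \1_(Bl x (dyad delta n)) y = 1 :> R.
  by rewrite indicE mem_set.
rewrite mule1 addeCA leeDl// adde_ge0 ?nneseries_ge0//.
by rewrite lee_fin mulr_ge0 ?powR_ge0.
Qed.

(** The pointwise dyadic bound is integrated against [f], sum and integral being exchanged by
    nonnegativity. The point [y = x], excluded from that bound, is null. *)
Lemma potential_le (c delta : R) (x : M) (k f : M -> R) :
  0 <= c -> 0 < delta -> Y x ->
  measurable_fun Y k -> (forall y, Y y -> 0 <= k y) ->
  (forall y, Y y -> x <> y -> k y * dist x y `^ s <= c) ->
  measurable_fun Y f -> (forall y, Y y -> 0 <= f y) ->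
  (\int[nu]_(y in Y) (k y * f y)%:E <=
    (c * delta `^ (- s))%:E * \int[nu]_(y in Y) (f y)%:E +
    \sum_(0 <= n <oo) ((weight c delta n)%:E *
       \int[nu]_(y in Bl x (dyad delta n)) (f y)%:E))%E.
Proof.
move=> c_ge0 d0 Yx mk k0 kc mf f0.
have f0E y : Y y -> (0 <= (f y)%:E)%E by rewrite lee_fin; exact: f0.
have mfE : measurable_fun Y (EFin \o f) by exact/measurable_EFinP.
pose T n y := ((weight c delta n)%:E * ((f y)%:E * (\1_(Bl x (dyad delta n)) y)%:E))%E.
have T0 n y : Y y -> (0 <= T n y)%E.
  by move=> Yy; rewrite !mule_ge0 ?lee_fin ?weight_ge0//; exact: f0.
have mI n : measurable_fun Y
    (fun y => ((f y)%:E * (\1_(Bl x (dyad delta n)) y)%:E)%E).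
  apply: emeasurable_funM => //.
  by apply/measurable_EFinP/measurable_indic/measurable_mball.
have mT n : measurable_fun Y (T n) by apply: emeasurable_funM.
have C0 : (0 <= (c * delta `^ (- s))%:E)%E by rewrite lee_fin mulr_ge0 ?powR_ge0.
have -> : (\sum_(0 <= n <oo) ((weight c delta n)%:E *
       \int[nu]_(y in Bl x (dyad delta n)) (f y)%:E))%E =
    (\sum_(0 <= n <oo) \int[nu]_(y in Y) T n y)%E.
  apply: eq_eseriesr => n _; rewrite ge0_integralZl_EFin ?weight_ge0//; last first.
    by move=> y Yy; rewrite mule_ge0//; exact: f0E.
  congr (_ * _)%E.
  transitivity (\int[nu]_(y in Y `&` Bl x (dyad delta n)) (f y)%:E)%E.
    by rewrite /Bl setICA setIid.
  by rewrite integral_mkcondr epatch_indic.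
rewrite -integral_nneseries// -ge0_integralZl_EFin ?mulr_ge0 ?powR_ge0//.
have mST : measurable_fun Y (fun y => \sum_(0 <= n <oo) T n y)%E.
  by apply: ge0_emeasurable_sum => // n y Yy _; exact: T0.
have ST0 y : Y y -> (0 <= \sum_(0 <= n <oo) T n y)%E.
  by move=> Yy; apply: nneseries_ge0 => n _ _; exact: T0.
rewrite -ge0_integralD//; last 2 first.
- by move=> y Yy; rewrite mule_ge0//; exact: f0E.
- by apply: emeasurable_funM.
apply: ae_ge0_le_integral => //.
- by move=> y Yy; rewrite lee_fin mulr_ge0 ?k0 ?f0.
- by apply/measurable_EFinP; exact: measurable_funM.
- by move=> y Yy; rewrite adde_ge0 ?ST0// mule_ge0//; exact: f0E.
- by apply: emeasurable_funD => //; exact: emeasurable_funM.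
exists ([set x] `&` Y); split; [exact: measurable_singleton|exact: measure_singleton|].
move=> y /= /not_implyP[Yy nle]; split => //; apply: contrapT => xy; apply: nle.
have := kernel_le_dyadic c delta (k y) x y c_ge0 d0 Yy (fun e => xy (esym e)) _.
move=> /(_ (kc _ Yy (fun e => xy (esym e)))) kle.
have -> : (\sum_(0 <= n <oo) T n y)%E = ((f y)%:E * \sum_(0 <= n <oo)
    (weight c delta n)%:E * (\1_(Bl x (dyad delta n)) y)%:E)%E.
  rewrite -nneseriesZl; last by move=> n _; rewrite mule_ge0 ?lee_fin ?weight_ge0.
  by apply: eq_eseriesr => n _; rewrite /T muleCA.
rewrite [X in (_ <= X + _)%E]muleC -ge0_muleDr//; last first.
  by apply: nneseries_ge0 => n _ _; rewrite mule_ge0 ?lee_fin ?weight_ge0.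
by rewrite EFinM muleC lee_wpmul2l//; exact: f0E.
Qed.

(** This is [potential_le] with [f] the indicator of [E]. The constant part gives [C%:E * nu E], and
    the dyadic sum is at most [e] by the choice of [delta], which involves none of [x], [k] and
    [E]. *)
Lemma kernel_uniformly_integrable (c e : R) : 0 <= c -> 0 < e ->
  exists2 C : R, 0 <= C & forall (x : M) (k : M -> R) (E : set M),
    Y x -> measurable_fun Y k -> (forall y, Y y -> 0 <= k y) ->
    (forall y, Y y -> x <> y -> k y * dist x y `^ s <= c) ->
    measurable E -> E `<=` Y ->
    (\int[nu]_(y in E) (k y)%:E <= C%:E * nu E + e%:E)%E.
Proof.
move=> c_ge0 e0; have [delta [d0 d5] sum_le] := weight_ball_sum c e c_ge0 e0.
exists (c * delta `^ (- s)); first by rewrite mulr_ge0 ?powR_ge0.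
move=> x k E Yx mk k0 kc mE EY.
have mIE : measurable_fun Y (\1_E : M -> R) by exact: measurable_indic.
have -> : (\int[nu]_(y in E) (k y)%:E = \int[nu]_(y in Y) (k y * \1_E y)%:E)%E.
  rewrite -(setIidr EY) integral_mkcondr epatch_indic (setIidr EY).
  by apply: eq_integral => y _; rewrite EFinM.
apply: le_trans (potential_le c delta x k _ c_ge0 d0 Yx mk k0 kc mIE _) _ => //.
rewrite integral_indic// (setIidl EY) leeD2l//; apply: le_trans sum_le.
apply: lee_nneseries => n.
  by move=> _ _; rewrite mule_ge0 ?lee_fin ?weight_ge0//; apply: integral_ge0.
move=> _; rewrite [leRHS]EFinM lee_wpmul2l ?lee_fin ?weight_ge0//.
have mB := measurable_mball x (dyad delta n).
rewrite integral_indic//.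
have dn0 := dyad_gt0 delta n d0.
have dn1 : dyad delta n <= delta.
  by apply: ler_piMr (ltW d0) _; rewrite exprn_ile1//; lra.
apply: (@le_trans _ _ (nu (Bl x (5 * dyad delta n)))).
  apply: le_measure; rewrite ?inE; [exact: measurableI|exact: measurable_mball|].
  by move=> y [_ [/= xy Yy]]; split => //; move: xy; rewrite /mball/=; lra.
by apply: ahlfors => //; lra.
Qed.


(** Each set where [a < f] is the trace on [D] of the open set [U] of points having a ball whose
    part in [D] satisfies [a < f]. *)
Lemma measurable_fun_continuous_on (D : set M) (f : M -> R) :
  D `<=` Y ->
  (forall y, D y -> forall e, 0 < e -> exists2 delta, 0 < delta &
     forall y', D y' -> dist y y' < delta -> `|f y' - f y| < e) ->
  measurable_fun D f.
Proof.
move=> DY fcont mD; apply: (measurability _ (RGenOInfty.measurableE R)) => //.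
have [_ deq0 _ tri] := dist_metric.
move=> _ [_ [a ->] <-].
pose U := [set z | exists2 rho, 0 < rho &
  forall y, D y -> dist z y < rho -> a < f y].
have -> : D `&` f @^-1` `]a, +oo[%classic = D `&` (U `&` Y).
  apply/seteqP; split => y [Dy].
    rewrite /= in_itv/= andbT => ay; split => //; split; last exact: DY.
    have [|delta d0 dP] := fcont y Dy (f y - a); first by rewrite subr_gt0.
    by exists delta => // y' Dy' /(dP _ Dy'); rewrite ltr_distl => /andP[+ _]; lra.
  move=> [[rho rho0 rhoP] Yy]; split => //=; rewrite in_itv/= andbT.
  by apply: rhoP => //; rewrite ((deq0 y y).2 erefl).
apply: measurableI => //; apply: mopen_measurable => z [rho rho0 rhoP].
exists (rho / 2); first by rewrite divr_gt0.
move=> x zx; exists (rho / 2); first by rewrite divr_gt0.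
move=> y Dy xy; apply: rhoP => //.
by have := tri z x y; move: zx; rewrite /mball/=; lra.
Qed.

(** * Integral operators applied to essentially bounded densities *)

Section integral_operator.
Context (c B : R) (k : M -> M -> R) (u : M -> R).
Hypotheses (nuY : (nu Y < +oo)%E) (c_ge0 : 0 <= c) (B_ge0 : 0 <= B)
  (k_le : forall x y, Y x -> Y y -> x <> y -> `|k x y| * dist x y `^ s <= c)
  (k_cont : forall x y, Y x -> Y y -> x <> y -> forall e, 0 < e ->
     exists2 delta, 0 < delta &
     forall x' y', Y x' -> Y y' -> x' <> y' -> dist x x' < delta ->
       dist y y' < delta -> `|k x' y' - k x y| < e)
  (mes_u : measurable_fun Y u)
  (u_le : {ae nu, forall y, Y y -> `|u y| <= B}).

(** Off [x] the function [k x] is continuous. Its value at [x] is arbitrary, but any function on a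
    singleton is measurable. *)
Lemma measurable_kernel (x : M) : Y x -> measurable_fun Y (k x).
Proof.
move=> Yx; have [_ deq0 _ _] := dist_metric.
have mx := measurable_singleton x.
have -> : Y = (Y `\` ([set x] `&` Y)) `|` ([set x] `&` Y).
  by rewrite setUC setDUK//; exact: subIsetr.
apply/measurable_funU => //; first exact: measurableD.
split; last first.
  have -> : [set x] `&` Y = [set x] by apply: setIidl => _ ->.
  exact: measurable_fun_set1.
apply: measurable_fun_continuous_on => [y []//|y [Yy xy] e e0].
have xny : x <> y by move=> yx; apply: xy.
have [delta d0 dP] := k_cont x y Yx Yy xny e e0.
exists delta => // y' [Yy' xy'] yy'; apply: dP => //.
  by move=> yx; apply: xy'.
by rewrite ((deq0 x x).2 erefl).
Qed.

Let Ku x y := k x y * u y.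

Let mKu x : Y x -> measurable_fun Y (Ku x).
Proof. by move=> Yx; apply: measurable_funM => //; exact: measurable_kernel. Qed.

Lemma kernel_bounded_uniformly_integrable (e : R) : 0 < e ->
  exists2 C : R, 0 <= C & forall (x : M) (E : set M),
    Y x -> measurable E -> E `<=` Y ->
    (\int[nu]_(y in E) `|Ku x y|%:E <= C%:E * nu E + e%:E)%E.
Proof.
move=> e0; have B1 : 0 < B + 1 by rewrite ltr_wpDl.
have [C C0 CP] := kernel_uniformly_integrable c (e / (B + 1)) c_ge0 (divr_gt0 e0 B1).
exists (B * C); first exact: mulr_ge0.
move=> x E Yx mE EY.
have mnk : measurable_fun Y (fun y => `|k x y|).
  by apply: measurableT_comp => //; exact: measurable_kernel.
have mnkE : measurable_fun E (fun y => `|k x y|%:E).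
  by apply/measurable_EFinP; exact: measurable_funS mnk.
apply: (@le_trans _ _ (\int[nu]_(y in E) (B%:E * `|k x y|%:E))%E).
  apply: ae_ge0_le_integral => //.
  - apply/measurable_EFinP; apply: measurableT_comp => //.
    by apply: measurable_funS (mKu x Yx).
  - by move=> y _; rewrite mule_ge0.
  - exact: emeasurable_funM.
  apply: filterS u_le => y uy Ey.
  rewrite -EFinM lee_fin normrM mulrC ler_wpM2r//; exact: uy (EY _ Ey).
rewrite ge0_integralZl_EFin//.
apply: (@le_trans _ _ (B%:E * (C%:E * nu E + (e / (B + 1))%:E))%E).
  apply: lee_wpmul2l => //; apply: (CP x (fun y => `|k x y|)) => // y Yy xy.
  exact: k_le.
rewrite ge0_muleDr; last 2 first.
- by rewrite mule_ge0.
- by rewrite lee_fin divr_ge0// ltW.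
rewrite muleA -!EFinM leeD2l// lee_fin mulrCA ler_piMr//; first exact: ltW.
by rewrite ler_pdivrMr// mul1r lerDl.
Qed.

Lemma integrable_kernel_mul x : Y x -> nu.-integrable Y (EFin \o Ku x).
Proof.
move=> Yx; apply/integrableP; split; first exact/measurable_EFinP/mKu.
have [C C0 CP] := kernel_bounded_uniformly_integrable 1 ltr01.
apply: le_lt_trans (CP x Y Yx mY (fun=> id)) _.
have -> : nu Y = (fine (nu Y))%:E by rewrite fineK// ge0_fin_numE.
by rewrite -EFinM -EFinD ltry.
Qed.

Let Rintegral_norm_le x E r : Y x -> measurable E -> E `<=` Y ->
  (\int[nu]_(y in E) `|Ku x y|%:E <= r%:E)%E -> `|\int[nu]_(y in E) Ku x y| <= r.
Proof.
move=> Yx mE EY le_r; rewrite -lee_fin; apply: le_trans le_r.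
have iE : nu.-integrable E (EFin \o Ku x).
  by apply: integrableS (integrable_kernel_mul x Yx).
rewrite EFin_normr_Rintegral//.
by apply: le_abse_integral => //; exact: measurable_int iE.
Qed.

Lemma integral_operator_bounded :
  exists C : R, forall x, Y x -> `|\int[nu]_(y in Y) Ku x y| <= C.
Proof.
have [C C0 CP] := kernel_bounded_uniformly_integrable 1 ltr01.
exists (C * fine (nu Y) + 1) => x Yx; apply: Rintegral_norm_le => //.
by rewrite EFinD EFinM fineK ?ge0_fin_numE//; exact: CP.
Qed.

(** For [x] within [eta / 2] of [x0], points outside the ball of radius [eta] about [x0] stay at
    distance at least [eta / 2] from [x]. The integrand is then dominated by a constant, integrable
    since [nu Y] is finite, and dominated convergence applies. *)
Lemma far_integral_continuous (eta e : R) (x0 : M) : Y x0 -> 0 < eta -> 0 < e ->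
  exists2 delta, 0 < delta & forall x, Y x -> dist x0 x < delta ->
    `|\int[nu]_(y in Y `\` Bl x0 eta) Ku x y -
      \int[nu]_(y in Y `\` Bl x0 eta) Ku x0 y| < e.
Proof.
move=> Yx0 eta0 e0; have [_ deq0 dC tri] := dist_metric.
set D := Y `\` Bl x0 eta.
have mD : measurable D by apply: measurableD => //; exact: measurable_mball.
have DY : D `<=` Y by move=> y [].
have farD y : D y -> eta <= dist x0 y.
  by move=> [Yy nB]; rewrite leNgt; apply/negP => yeta; apply: nB.
apply: contrapT => nodelta.
(* A failure of continuity yields points [x_ n] within [d n] of [x0], where [d n] tends to 0 and
   never exceeds [eta / 2]. *)
pose d n : R := eta / 2 * n.+1%:R^-1.
have d0 n : 0 < d n by rewrite mulr_gt0// ?invr_gt0//; lra.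
have /choice[x_ x_P] n : exists x, [/\ Y x, dist x0 x < d n &
    e <= `|\int[nu]_(y in D) Ku x y - \int[nu]_(y in D) Ku x0 y|].
  apply: contrapT => nox; apply: nodelta; exists (d n) => // x Yx xd.
  by rewrite ltNge; apply/negP => ex; apply: nox; exists x.
have Yx_ n : Y (x_ n) by have [] := x_P n.
have iD x : Y x -> nu.-integrable D (EFin \o Ku x).
  by move=> Yx; apply: integrableS (integrable_kernel_mul x Yx).
have d_cvg : d n @[n --> \oo] --> (0 : R).
  rewrite -[X in _ --> X](mulr0 (eta / 2)); apply: cvgM; first exact: cvg_cst.
  exact: cvg_harmonic.
have d_le n : d n <= eta / 2.
  by rewrite ler_piMr ?invf_le1 ?ler1n//; lra.
have [_ _ cvgI] : [/\ nu.-integrable D (EFin \o Ku x0),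
    [sequence (\int[nu]_(y in D) `|(EFin \o Ku (x_ n)) y - (EFin \o Ku x0) y|)%E]_n
      @ \oo --> 0%E &
    [sequence (\int[nu]_(y in D) (EFin \o Ku (x_ n)) y)%E]_n @ \oo -->
      (\int[nu]_(y in D) (EFin \o Ku x0) y)%E].
  apply: (@dominated_convergence _ _ _ nu D mD (fun n => EFin \o Ku (x_ n))
    (EFin \o Ku x0) (EFin \o cst (c * (eta / 2) `^ (- s) * B))).
  - by move=> n; exact: measurable_int (iD _ (Yx_ n)).
  - exact: measurable_int (iD _ Yx0).
  - apply: aeW => y Dy; apply/cvg_EFin; first by near=> n.
    apply: cvgM; last exact: cvg_cst.
    have Yy := DY _ Dy; have yeta := farD _ Dy.
    have x0y : x0 <> y by move=> x0y; move: yeta; rewrite x0y ((deq0 y y).2 erefl); lra.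
    apply/cvgrPdist_lt => e' e'0.
    have [delta delta0 dP] := k_cont x0 y Yx0 Yy x0y e' e'0.
    near=> n; rewrite distrC; apply: dP => //.
    + move=> xy; have [_ + _] := x_P n; rewrite xy; have := d_le n; lra.
    + have [_ xd _] := x_P n; apply: lt_le_trans xd _.
      by rewrite -[leLHS]gtr0_norm// -normrN -sub0r; near: n;
         move/cvgrPdist_le : d_cvg; exact.
    + by rewrite ((deq0 y y).2 erefl).
  - apply/integrableP; split.
      by apply/measurable_EFinP; exact: measurable_cst.
    set v := c * (eta / 2) `^ (- s) * B.
    rewrite (integral_cst nu mD `|v|%:E) -ge0_fin_numE ?mule_ge0//.
    rewrite fin_numM// ge0_fin_numE//; apply: le_lt_trans nuY.
    by apply: le_measure; rewrite ?inE.
  - apply: filterS u_le => y uy n Dy; have Yy := DY _ Dy.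
    rewrite /= lee_fin normrM; apply: ler_pM => //; last exact: uy.
    have far : eta / 2 <= dist (x_ n) y.
      have [_ xd _] := x_P n.
      by have := tri x0 (x_ n) y; have := farD _ Dy; have := d_le n; lra.
    have eta20 : 0 < eta / 2 by rewrite divr_gt0.
    have xny : x_ n <> y.
      by move=> xy; move: far; rewrite xy ((deq0 y y).2 erefl); lra.
    rewrite powRN ler_pdivlMr ?powR_gt0//; apply: le_trans (k_le _ _ (Yx_ n) Yy xny).
    apply: ler_wpM2l => //; apply: ge0_ler_powR; rewrite ?nnegrE//; lra.
have {cvgI} : (\int[nu]_(y in D) Ku (x_ n) y)%R @[n --> \oo] -->
    (\int[nu]_(y in D) Ku x0 y)%R.
  by apply: fine_cvg; rewrite fineK//; exact: integrable_fin_num (iD _ Yx0).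
move=> /cvgrPdist_lt/(_ e e0)[N _ /(_ N (leqnn N))].
by have [_ _] := x_P N; rewrite distrC leNgt => /negP.
Unshelve. all: by end_near. Qed.

(** The domain is split at a small ball about the fixed point [x0]. Uniform integrability makes the
    integral over the ball small for all [x] at once, and the rest is continuous at [x0]. *)
Lemma integral_operator_continuous (x0 : M) (e : R) : Y x0 -> 0 < e ->
  exists2 delta, 0 < delta & forall x, Y x -> dist x0 x < delta ->
    `|\int[nu]_(y in Y) Ku x y - \int[nu]_(y in Y) Ku x0 y| < e.
Proof.
move=> Yx0 e0; have e8 : 0 < e / 8 by rewrite divr_gt0.
have [C C0 CP] := kernel_bounded_uniformly_integrable (e / 8) e8.
(* Each of the two near integrals is at most [e / 8 + e / 8], and the far difference is below
   [e / 2]: below [e] in total. *)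
have [eta /andP[eta0 eta_r1] etaC] := powR_small ups (C * c0) (e / 8) r1
  (le_lt_trans s0 s_ups) (mulr_ge0 C0 (ltW c0_gt0)) e8 r1_gt0.
have e2 : 0 < e / 2 by rewrite divr_gt0.
have [delta delta0 dP] := far_integral_continuous eta (e / 2) x0 Yx0 eta0 e2.
exists delta => // x Yx xd.
have mB := measurable_mball x0 eta.
have BY : Bl x0 eta `<=` Y by move=> y [].
have near_le x' : Y x' -> `|\int[nu]_(y in Bl x0 eta) Ku x' y| <= e / 4.
  move=> Yx'; apply: Rintegral_norm_le => //.
  apply: le_trans (CP x' _ Yx' mB BY) _.
  apply: (@le_trans _ _ (C%:E * (c0 * eta `^ ups)%:E + (e / 8)%:E)%E).
    by rewrite leeD2r// lee_wpmul2l//; exact: ahlfors.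
  by rewrite -EFinM -EFinD lee_fin mulrA; lra.
have splitY x' : Y x' -> \int[nu]_(y in Y) Ku x' y =
    \int[nu]_(y in Bl x0 eta) Ku x' y + \int[nu]_(y in Y `\` Bl x0 eta) Ku x' y.
  move=> Yx'; rewrite -Rintegral_setU//.
  - by rewrite setDUK.
  - exact: measurableD.
  - by rewrite setDUK//; exact: integrable_kernel_mul.
  - by rewrite disj_set2E setDIK.
rewrite !splitY//.
have := near_le _ Yx; have := near_le _ Yx0; have := dP _ Yx xd.
rewrite ltr_norml !ler_norml ltr_norml; lra.
Qed.


Lemma integral_operator_C0b :
  C0b_real dist Y (fun x => \int[nu]_(y in Y) (k x y * u y)).
Proof.
split; last exact: integral_operator_bounded.
by move=> x e Yx e0; exact: integral_operator_continuous.
Qed.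

End integral_operator.

(** * The integral equation with a square-integrable solution *)

Section integral_equation.
Context (c : R) (K : M -> M -> R[i]) (g mu : M -> R[i]).
Hypotheses (nuY : (nu Y < +oo)%E) (c_ge0 : 0 <= c)
  (K_le : forall x y, Y x -> Y y -> x <> y -> cabs (K x y) * dist x y `^ s <= c)
  (K_cont : forall x y, Y x -> Y y -> x <> y -> forall e, 0 < e ->
     exists2 delta, 0 < delta &
     forall x' y', Y x' -> Y y' -> x' <> y' -> dist x x' < delta ->
       dist y y' < delta -> cabs (K x' y' - K x y) < e)
  (gC : C0b dist Y g) (muL2 : L2 nu Y mu)
  (mu_eq : {ae nu, forall x, Y x -> mu x - intop nu Y K mu x = g x}).

Let ReK_le x y : Y x -> Y y -> x <> y ->
  `|complex.Re (K x y)| * dist x y `^ s <= c.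
Proof.
move=> Yx Yy xy; apply: le_trans (K_le x y Yx Yy xy).
by rewrite ler_wpM2r ?powR_ge0// normr_Re_le.
Qed.

Let ImK_le x y : Y x -> Y y -> x <> y ->
  `|complex.Im (K x y)| * dist x y `^ s <= c.
Proof.
move=> Yx Yy xy; apply: le_trans (K_le x y Yx Yy xy).
by rewrite ler_wpM2r ?powR_ge0// normr_Im_le.
Qed.

Let ReK_cont x y : Y x -> Y y -> x <> y -> forall e, 0 < e ->
     exists2 delta, 0 < delta &
     forall x' y', Y x' -> Y y' -> x' <> y' -> dist x x' < delta ->
       dist y y' < delta -> `|complex.Re (K x' y') - complex.Re (K x y)| < e.
Proof.
move=> Yx Yy xy e e0; have [delta d0 dP] := K_cont x y Yx Yy xy e e0.
exists delta => // x' y' Yx' Yy' xy' xd yd.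
by rewrite -ReB; apply: le_lt_trans (dP x' y' Yx' Yy' xy' xd yd); exact: normr_Re_le.
Qed.

Let ImK_cont x y : Y x -> Y y -> x <> y -> forall e, 0 < e ->
     exists2 delta, 0 < delta &
     forall x' y', Y x' -> Y y' -> x' <> y' -> dist x x' < delta ->
       dist y y' < delta -> `|complex.Im (K x' y') - complex.Im (K x y)| < e.
Proof.
move=> Yx Yy xy e e0; have [delta d0 dP] := K_cont x y Yx Yy xy e e0.
exists delta => // x' y' Yx' Yy' xy' xd yd.
by rewrite -ImB; apply: le_lt_trans (dP x' y' Yx' Yy' xy' xd yd); exact: normr_Im_le.
Qed.

Let mReK x : Y x -> measurable_fun Y (fun y => complex.Re (K x y)).
Proof. by move=> Yx; exact: (measurable_kernel (fun x y => complex.Re (K x y))). Qed.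

Let mImK x : Y x -> measurable_fun Y (fun y => complex.Im (K x y)).
Proof. by move=> Yx; exact: (measurable_kernel (fun x y => complex.Im (K x y))). Qed.

Let measurable_cabs (f : M -> R[i]) :
  measurable_fun Y (fun y => complex.Re (f y)) ->
  measurable_fun Y (fun y => complex.Im (f y)) ->
  measurable_fun Y (fun y => cabs (f y)).
Proof.
move=> mr mi.
have msqrt : measurable_fun setT (@Num.sqrt R).
  by apply: continuous_measurable_fun; exact: sqrt_continuous.
apply: (measurableT_comp msqrt
  (_ : measurable_fun Y (fun y => complex.Re (f y) ^+ 2 + complex.Im (f y) ^+ 2))).
by apply: measurable_funD; apply: measurable_funX.
Qed.

(** Integrability is not assumed, as [K x y * mu y] is not yet known to be integrable in [y]. When
    the integral of [h] is infinite, its real value defaults to 0 and the bound is trivial. *)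
Let norm_Rintegral_le (h : M -> R) : measurable_fun Y h ->
  (`|\int[nu]_(y in Y) h y|%:E <= \int[nu]_(y in Y) `|h y|%:E)%E.
Proof.
move=> mh; apply: le_trans; last first.
  by apply: (@le_abse_integral _ _ _ nu Y (EFin \o h)) => //; exact/measurable_EFinP.
by rewrite /Rintegral; case: integral => [r| |]; rewrite /= ?normr0 ?leey.
Qed.

(** The real and imaginary parts of the integral operator are each bounded by the integral of
    [cabs (K x y) * cabs (mu y)]. The resulting factor 2 is moved into the kernel, whose constant
    becomes [2 * c]; [potential_le] then gives the form required by [ae_bounded_of_potential_le]. *)
Lemma solution_ae_bounded :
  exists2 B : R, 0 <= B & {ae nu, forall x, Y x -> cabs (mu x) <= B}.
Proof.
have [mr mi L2fin] := muL2.
pose f x := cabs (mu x).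
have mf : measurable_fun Y f by exact: measurable_cabs.
have f0 y : Y y -> 0 <= f y by move=> _; exact: cabs_ge0.
have ffin : (\int[nu]_(y in Y) (f y)%:E < +oo)%E.
  (* The measure being finite, [t <= 1 + t ^ 2] turns square integrability into integrability. *)
  apply: (@le_lt_trans _ _ (\int[nu]_(y in Y) (1%:E + (f y ^+ 2)%:E))%E).
    apply: ge0_le_integral => //.
    - exact/measurable_EFinP.
    - apply/measurable_EFinP; apply: measurable_funD => //.
      exact: measurable_funX.
    - move=> y _; rewrite -EFinD lee_fin.
      by have := sqr_ge0 (f y - 1); have := cabs_ge0 _ (mu y); rewrite -/(f y); nra.
  rewrite ge0_integralD//; last 2 first.
  - by move=> y _; rewrite lee_fin sqr_ge0.
  - by apply/measurable_EFinP; exact: measurable_funX.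
  by rewrite (integral_cst nu mY 1%:E) mul1e lte_add_pinfty.
have c2 : 0 <= 2 * c by rewrite mulr_ge0.
have [delta [d0 d5] sum_le] := weight_ball_sum (2 * c) 2^-1 c2 ltac:(lra).
have [_ [Cg gb]] := gC.
have Cg0 : 0 <= `|Cg| by [].
pose I := fine (\int[nu]_(y in Y) (f y)%:E)%E.
have I0 : 0 <= I by apply: fine_ge0; apply: integral_ge0 => y /f0.
have IE : (\int[nu]_(y in Y) (f y)%:E)%E = I%:E.
  by rewrite fineK// ge0_fin_numE//; apply: integral_ge0 => y /f0.
(* [G] gathers the bound of [g] and the constant part of the potential estimate. *)
pose G := `|Cg| + 2 * c * delta `^ (- s) * I.
have G0 : 0 <= G by rewrite addr_ge0// !mulr_ge0 ?powR_ge0.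
exists (2 * G); first by rewrite mulr_ge0.
apply: (@ae_bounded_of_potential_le (dyad delta) (weight (2 * c) delta)
  (fun k => c0 * (5 * dyad delta k) `^ ups) f G) => //.
- by move=> k; exact: dyad_gt0.
- by move=> k; exact: weight_ge0.
- by move=> k; rewrite mulr_ge0 ?powR_ge0// ltW.
- move=> k y Yy; have dk0 := dyad_gt0 delta k d0.
  apply: ahlfors => //; first by rewrite mulr_gt0.
  have dk1 : dyad delta k <= delta.
    by apply: ler_piMr (ltW d0) _; rewrite exprn_ile1//; lra.
  lra.
apply: filterS mu_eq => x mux Yx.
have mcK : measurable_fun Y (fun y => cabs (K x y)).
  by apply: measurable_cabs; [exact: mReK|exact: mImK].
have m2K : measurable_fun Y (fun y => 2 * cabs (K x y)) by exact: measurable_funM.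
have mRe : measurable_fun Y (fun y => complex.Re (K x y * mu y)).
  apply: (eq_measurable_fun (fun y => complex.Re (K x y) * complex.Re (mu y) -
      complex.Im (K x y) * complex.Im (mu y))) => [y _|]; first by rewrite ReM.
  by apply: measurable_funB; apply: measurable_funM => //; [exact: mReK|exact: mImK].
have mIm : measurable_fun Y (fun y => complex.Im (K x y * mu y)).
  apply: (eq_measurable_fun (fun y => complex.Re (K x y) * complex.Im (mu y) +
      complex.Im (K x y) * complex.Re (mu y))) => [y _|]; first by rewrite ImM.
  by apply: measurable_funD; apply: measurable_funM => //; [exact: mReK|exact: mImK].
have mKf : measurable_fun Y (fun y => (cabs (K x y) * f y)%:E).
  by apply/measurable_EFinP; exact: measurable_funM.
pose J := (\int[nu]_(y in Y) (cabs (K x y) * f y)%:E)%E.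
have leJ (h : M -> R) : measurable_fun Y h ->
    (forall y, `|h y| <= cabs (K x y) * f y) ->
    (`|\int[nu]_(y in Y) h y|%:E <= J)%E.
  move=> mh hle; apply: le_trans (norm_Rintegral_le h mh) _.
  apply: ge0_le_integral => //.
    by apply/measurable_EFinP; exact: measurableT_comp.
  by move=> y _; rewrite lee_fin.
have fx : f x <= `|Cg| + (`|complex.Re (intop nu Y K mu x)| +
    `|complex.Im (intop nu Y K mu x)|).
  have -> : f x = cabs (g x + intop nu Y K mu x).
    by rewrite -(mux Yx) subrK.
  rewrite cabsE; apply: le_trans (le_normcD _ _) _; rewrite -!cabsE.
  apply: lerD; last exact: cabs_le.
  by apply: le_trans (gb x Yx) _; exact: ler_norm.
apply: (@le_trans _ _ (`|Cg|%:E + (J + J))%E).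
  apply: (@le_trans _ _ (`|Cg|%:E + (`|complex.Re (intop nu Y K mu x)|%:E +
      `|complex.Im (intop nu Y K mu x)|%:E))%E); first by rewrite lee_fin.
  apply: leeD => //; apply: leeD; apply: leJ => // y; rewrite -cabsM.
    exact: normr_Re_le.
  exact: normr_Im_le.
have -> : (J + J = \int[nu]_(y in Y) (2 * cabs (K x y) * f y)%:E)%E.
  under [RHS]eq_integral do rewrite -mulrA EFinM.
  rewrite ge0_integralZl_EFin//; last first.
    by move=> y _; rewrite lee_fin mulr_ge0 ?cabs_ge0.
  by rewrite -/J mule_natl.
rewrite EFinD -addeA leeD2l//.
rewrite EFinM -IE; apply: potential_le => //.
- by move=> y _; rewrite mulr_ge0 ?cabs_ge0.
- by move=> y Yy xy; rewrite -mulrA ler_wpM2l//; exact: K_le.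
Qed.

(** Once [mu] is essentially bounded, the regularity of [g + A[K, mu]] follows from four real
    integral operators pairing the components of [K] with those of [mu]. Their integrability allows
    the integral of each component of the product to be split. *)
Lemma solution_C0b :
  exists2 mu' : M -> R[i], C0b dist Y mu' & {ae nu, forall x, Y x -> mu x = mu' x}.
Proof.
have [B B0 muB] := solution_ae_bounded; have [mr mi _] := muL2.
have rB : {ae nu, forall y, Y y -> `|complex.Re (mu y)| <= B}.
  by apply: filterS muB => y yB /yB; apply: le_trans; exact: normr_Re_le.
have iB : {ae nu, forall y, Y y -> `|complex.Im (mu y)| <= B}.
  by apply: filterS muB => y yB /yB; apply: le_trans; exact: normr_Im_le.
pose rK x y := complex.Re (K x y); pose iK x y := complex.Im (K x y).
pose rmu y := complex.Re (mu y); pose imu y := complex.Im (mu y).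
have rr := integral_operator_C0b c B rK rmu nuY c_ge0 B0 ReK_le ReK_cont mr rB.
have ri := integral_operator_C0b c B rK imu nuY c_ge0 B0 ReK_le ReK_cont mi iB.
have ir := integral_operator_C0b c B iK rmu nuY c_ge0 B0 ImK_le ImK_cont mr rB.
have ii := integral_operator_C0b c B iK imu nuY c_ge0 B0 ImK_le ImK_cont mi iB.
have irr x := integrable_kernel_mul c B rK rmu nuY c_ge0 B0 ReK_le ReK_cont mr rB x.
have iri x := integrable_kernel_mul c B rK imu nuY c_ge0 B0 ReK_le ReK_cont mi iB x.
have iir x := integrable_kernel_mul c B iK rmu nuY c_ge0 B0 ImK_le ImK_cont mr rB x.
have iii x := integrable_kernel_mul c B iK imu nuY c_ge0 B0 ImK_le ImK_cont mi iB x.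
have eq_C0b (f h : M -> R) : (forall x, Y x -> f x = h x) ->
    C0b_real dist Y f -> C0b_real dist Y h.
  move=> fh [fc [C fb]]; split; last by exists C => x Yx; rewrite -fh//; exact: fb.
  move=> x e Yx e0; have [delta d0 dP] := fc x e Yx e0.
  by exists delta => // y Yy; rewrite -!fh//; exact: dP.
have [gr gi] := C0bP.1 gC.
exists (fun x => g x + intop nu Y K mu x); last first.
  by apply: filterS mu_eq => x mux Yx; rewrite -(mux Yx) subrK.
apply/C0bP; split.
  apply: eq_C0b (C0b_realD gr (C0b_realD rr (C0b_realN ii))).
  move=> x Yx; rewrite ReD -RintegralB; [|exact: mY|exact: irr|exact: iii].
  by congr (_ + _); apply: eq_Rintegral => y _; rewrite ReM.
apply: eq_C0b (C0b_realD gi (C0b_realD ri ir)).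
move=> x Yx; rewrite ImD -RintegralD; [|exact: mY|exact: iri|exact: iir].
by congr (_ + _); apply: eq_Rintegral => y _; rewrite ImM.
Qed.

End integral_equation.
End singular_kernel.
End metric_measure.

Theorem theorem5p1 (R : realType) (disp : measure_display) (M : measurableType disp)
  (dist : M -> M -> R) (Y : set M) (nu : {measure set M -> \bar R})
  (upsY s : R) (K : M -> M -> R[i]) (g mu : M -> R[i]) :
  is_metric dist ->
  mbounded dist Y ->
  measurable Y ->
  Borel_sets_of dist Y `<=` measurable ->
  (forall x r, Y x -> 0 < r -> (nu (mball dist x r `&` Y) < +oo)%E) ->
  0 < upsY -> 0 <= s -> s < upsY ->
  (exists r0 : \bar R, exists2 c0 : R, (0%:E < r0)%E /\ 0 < c0 &
     forall x r, Y x -> 0 < r -> (r%:E < r0)%E ->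
       (nu (mball dist x r `&` Y) <= (c0 * powR r upsY)%:E)%E) ->
  Kclass dist Y s K ->
  C0b dist Y g ->
  L2 nu Y mu ->
  {ae nu, forall x, Y x -> mu x - intop nu Y K mu x = g x} ->
  exists2 mu' : M -> R[i], C0b dist Y mu' & {ae nu, forall x, Y x -> mu x = mu' x}.
Proof.
move=> dist_metric [b bP] mY borelY ballfin _ s0 s_ups
  [r0 [c0 [r0_gt0 c0_gt0] ahlfors]] [K_cont [c cP]] gC muL2 mu_eq.
(* The Ahlfors radius may be [+oo]; the real radius 1 replaces it in that case. *)
have [r1 r1_gt0 r1r0] : exists2 r1 : R, 0 < r1 & (r1%:E <= r0)%E.
  case: r0 r0_gt0 {ahlfors} => [r| |]// r_gt0; last by exists 1; rewrite ?leey.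
  by exists r; rewrite ?lexx.
(* A nonempty bounded [Y] is contained in a ball about any of its points, the radius [b + 1] giving
   the strict inequality of open balls. *)
have nuY : (nu Y < +oo)%E.
  have [[x Yx]|Y0] := pselect (Y !=set0); last first.
    have -> : Y = set0 by apply/seteqP; split => // x Yx; apply: Y0; exists x.
    by rewrite measure0.
  have b0 : 0 <= b.
    by have [d0 _ _ _] := dist_metric; exact: le_trans (d0 x x) (bP _ _ Yx Yx).
  rewrite (_ : Y = mball dist x (b + 1) `&` Y).
    by apply: ballfin => //; rewrite ltr_wpDl.
  apply/seteqP; split => [y Yy|y []//]; split => //.
  by apply: le_lt_trans (bP _ _ Yx Yy) _; rewrite ltrDl.
(* The absolute value of [c] is taken because [c] may be negative when [Y] has no two distinct
   points. *)
apply: (solution_C0b R disp M dist Y nu dist_metric mY borelY s upsY c0 r1 s0 s_ups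
  c0_gt0 r1_gt0 _ `|c| K g mu nuY (normr_ge0 c) _ K_cont gC muL2 mu_eq).
- by move=> x r Yx r_gt0 rr1; apply: ahlfors => //; apply: lt_le_trans r1r0.
- by move=> x y Yx Yy xy; apply: le_trans (ler_norm c); exact: cP.
Qed.
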